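(* Let $\boldsymbol{C}=(c_0,c_1,\ldots,c_k)\in\{0,1\}^{k+1}$ and $\boldsymbol{C}'=(1,\ldots,1)-\boldsymbol{C}$. For all $k,n\in\mathbb{N}^+$ and $m\in\mathbb{N}$ (including $m=0$) define $$O_{\boldsymbol{C}\max}(n,m+c_k-1)=\begin{cases}\dfrac{(n-1)!^k}{(m-1)!}\,(\boldsymbol{H}_n\cdot\boldsymbol{C}^T)^{m-1}\displaystyle\prod_{i=1}^{n-m}F_{i+1}(\boldsymbol{C}'),&1\le m\le n,\\[2mm] 0,&\text{otherwise},\end{cases}$$ where $\boldsymbol{H}_n=(h_0,h_1,\ldots,h_k)$ with $h_p=\binom{k}{p}\sum_{j=1}^{n-1}\frac{1}{j^p}$. Then $$O_{\boldsymbol{C}\max}(n,m+c_k-1)\ge O_{\boldsymbol{C}}(n,m+c_k-1).$$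
   Context: Optimization set: let $U$ be a finite set of $d$-dimensional vectors and $\boldsymbol{R}=(R_1,\ldots,R_d)$ a vector of relations; write $(\boldsymbol{x},\boldsymbol{y})\in\boldsymbol{R}$ if $(x_i,y_i)\in R_i$ for all $i$. A subset $A\subseteq U$ is a majorization set of $U$ by $\boldsymbol{R}$ if for every $\boldsymbol{u}\in U$ there is $\boldsymbol{a}\in A$ with $(\boldsymbol{a},\boldsymbol{u})\in\boldsymbol{R}$ or $\boldsymbol{a}=\boldsymbol{u}$. An optimization set is a majorization set of minimum cardinality. $\boldsymbol{C}$ sequential optimization numbers: let $k,n\ge1$ and $\boldsymbol{C}=(c_0,\ldots,c_k)\in\{0,1\}^{k+1}$. Consider arrays $(a_{ij})_{1\le i\le n,\,1\le j\le k}$ such that for each $j$ the sequence $(a_{1j},\ldots,a_{nj})$ is a permutation of $\{1,\ldots,n\}$ (there are $n!^k$ such arrays). For each $j$ let $b_{ij}=(i,a_{ij})$, $U_j=\{b_{1j},\ldots,b_{nj}\}$, and let $S_j$ be the optimization set of $U_j$ by $(<,<)$ (so $b_{ij}\in S_j$ iff $a_{ij}<a_{i'j}$ for all $i'<i$). For each $i$ let $l_i$ be the number of $j\in\{1,\ldots,k\}$ with $b_{ij}\in S_j$; the index $i$ is selected iff $c_{l_i}=1$. Then $O_{\boldsymbol{C}}(n,m)$ is the number of arrays for which exactly $m$ indices $i\in\{1,\ldots,n\}$ are selected (so it is $0$ if $m<0$). For $j\ge2$, $F_j(\boldsymbol{C})=\sum_{p=0}^k c_p\binom{k}{p}\frac{1}{(j-1)^p}$,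 and $F_j(\boldsymbol{C}')$ is defined by the same formula with $c_p$ replaced by $c'_p=1-c_p$. Moreover $\boldsymbol{H}_n\cdot\boldsymbol{C}^T=\sum_{p=0}^k h_pc_p$. Empty products equal $1$, empty sums equal $0$, and a zeroth power equals $1$ (including $0^0=1$). *)

(* Defs.v *)
From HB Require Import structures.
From mathcomp Require Import all_boot all_order all_algebra perm.

Set Implicit Arguments.
Unset Strict Implicit.
Unset Printing Implicit Defensive.

Import Order.TTheory GRing.Theory Num.Theory.
Local Open Scope ring_scope.

Section OptimizationSet.

Variables (T : finType) (d : nat).
Implicit Types (R : d.-tuple (rel T)) (x y : d.-tuple T) (U A : {set d.-tuple T}).

Definition vrel R x y : bool := [forall i, tnth R i (tnth x i) (tnth y i)].

Definition majorization_set R U A : bool :=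
  (A \subset U) &&
  [forall u in U, [exists a in A, vrel R a u || (a == u)]].

Definition is_optimization_set R U A : bool :=
  majorization_set R U A &&
  [forall B : {set d.-tuple T}, majorization_set R U B ==> (#|A| <= #|B|)%N].

(* The sets satisfying [is_optimization_set] are not unique for arbitrary
   relations; this picks one of them.  It is the only one when [vrel R] is a
   strict order, see [optimization_set_strict_order]. *)
Definition optimization_set R U : {set d.-tuple T} :=
  [arg min_(A < U | majorization_set R U A) #|A|].

Lemma majorization_set_refl R U : majorization_set R U U.
Proof.
apply/andP; split=> //; apply/'forall_implyP => u Uu.
by apply/existsP; exists u; rewrite Uu eqxx orbT.
Qed.

Lemma optimization_setP R U : is_optimization_set R U (optimization_set R U).
Proof.
rewrite /optimization_set; case: arg_minnP => [|A AU minA].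
  exact: majorization_set_refl.
by rewrite /is_optimization_set AU; apply/'forall_implyP => B /minA.
Qed.

Lemma optimization_set_strict_order R U A :
    irreflexive (vrel R) -> transitive (vrel R) ->
  is_optimization_set R U A = (A == [set x in U | ~~ [exists y in U, vrel R y x]]).
Proof.
move=> irrR trR; set M := [set x in U | _].
have subM B : majorization_set R U B -> M \subset B.
  case/andP=> /subsetP BU /'forall_implyP majB; apply/subsetP => x.
  rewrite inE => /andP[Ux minx]; have /existsP[b /andP[Bb]] := majB x Ux.
  case/orP=> [Rbx|/eqP <- //]; case/negP: minx.
  by apply/existsP; exists b; rewrite BU.
have majM : majorization_set R U M.
  apply/andP; split; first by apply/subsetP => x; rewrite inE => /andP[].
  apply/'forall_implyP => u Uu.
  pose below x := [set y in U | vrel R y x || (y == x)].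
  pose P x := (x \in U) && (vrel R x u || (x == u)).
  have Pu : P u by rewrite /P Uu eqxx orbT.
  have [x /andP[Ux Rxu] minx] := arg_minnP (fun x => #|below x|) Pu.
  apply/existsP; exists x; rewrite Rxu andbT inE Ux /=.
  apply/negP => /existsP[y /andP[Uy Ryx]].
  have Ryu : vrel R y u by case/orP: Rxu => [/(trR _ _ _ Ryx)|/eqP <-].
  have := minx y; rewrite /P Uy Ryu => /(_ isT); rewrite leqNgt => /negP; apply.
  apply: proper_card; apply/properP; split.
    apply/subsetP => z; rewrite !inE => /andP[-> /orP[Rzy|/eqP->]] /=.
      by rewrite (trR _ _ _ Rzy Ryx).
    by rewrite Ryx.
  exists x; rewrite !inE Ux ?eqxx ?orbT //=; apply/norP; split.
    by apply/negP => /(trR _ _ _ Ryx); rewrite irrR.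
  by apply/eqP => xy; rewrite -xy irrR in Ryx.
apply/idP/eqP => [/andP[majA /'forall_implyP minA] | ->].
  by apply/esym/eqP; rewrite eqEcard subM // minA.
by rewrite /is_optimization_set majM; apply/'forall_implyP => B /subM/subset_leq_card.
Qed.

End OptimizationSet.

Section SequentialNumbers.

Variable k : nat.
Implicit Types (C : k.+1.-tuple bool) (n m : nat).

(* [coef C p] is c_p, which is 1 when true and 0 when false. *)
Definition coef C (p : nat) : bool := nth false C p.

Definition compl C : k.+1.-tuple bool := [tuple ~~ tnth C p | p < k.+1].

(* An array (a_ij) is the family of its columns, with rows, columns and values
   numbered from 0: a_ij is [a j i]. *)
Definition array n : finType := {ffun 'I_k -> 'S_n}.

Definition point n (a : array n) (j : 'I_k) (i : 'I_n) : 2.-tuple 'I_n :=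
  [tuple i; a j i].

Definition lt_lt n : 2.-tuple (rel 'I_n) :=
  [tuple (fun x y : 'I_n => (x < y)%N); (fun x y : 'I_n => (x < y)%N)].

Definition points n (a : array n) (j : 'I_k) : {set 2.-tuple 'I_n} :=
  [set point a j i | i : 'I_n].

Definition opt_points n (a : array n) (j : 'I_k) : {set 2.-tuple 'I_n} :=
  optimization_set (lt_lt n) (points a j).

Definition hits n (a : array n) (i : 'I_n) : nat :=
  #|[set j : 'I_k | point a j i \in opt_points a j]|.

Definition selected C n (a : array n) : {set 'I_n} :=
  [set i | coef C (hits a i)].

Definition seqopt_num C n (t : int) : nat :=
  #|[set a : array n | #|selected C a|%:Z == t]|.

Definition Fsum C (j : nat) : rat :=
  \sum_(p < k.+1) (coef C p)%:R * 'C(k, p)%:R * (1 / (j%:R - 1) ^+ p).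

Definition Hvec n (p : nat) : rat :=
  'C(k, p)%:R * \sum_(1 <= j < n) 1 / j%:R ^+ p.

Definition HdotC C n : rat := \sum_(p < k.+1) Hvec n p * (coef C p)%:R.

(* The number with second argument t = m + c_k - 1 is given by a formula in m,
   which is recovered here as t - c_k + 1. *)
Definition seqopt_max C n (t : int) : rat :=
  if t - (coef C k)%:Z + 1 is Posz m then
    if (1 <= m <= n)%N then
      ((n - 1)`! ^ k)%:R / (m - 1)`!%:R * HdotC C n ^+ (m - 1)
        * \prod_(1 <= i < (n - m).+1) Fsum (compl C) (i + 1)
    else 0
  else 0.

Lemma seqopt_maxE C n m :
  seqopt_max C n (m%:Z + (coef C k)%:Z - 1) =
    if (1 <= m <= n)%N then
      ((n - 1)`! ^ k)%:R / (m - 1)`!%:R * HdotC C n ^+ (m - 1)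
        * \prod_(1 <= i < (n - m).+1) Fsum (compl C) (i + 1)
    else 0.
Proof. by rewrite /seqopt_max [_ - _ + 1]addrAC subrK addrK. Qed.

End SequentialNumbers.

(* Main.v *)
(* For a uniformly random permutation, the events "position i is a left-to-right
   minimum" are independent of probability 1/i: in terms of the Lehmer code, which
   ranges over all sequences with i-th term in {0, ..., i-1}, the i-th term is 0.
   Hence the generating polynomial of the number of selected indices is
     X^(c_k) * (n-1)!^k * prod_(2 <= i <= n) (F_i(C) X + F_i(C')).
   The sequence F_i(C') is nonincreasing, and the coefficient of X^r in
   prod_(i < N) (f_i X + g_i), with g nonincreasing, is at most
   (sum_(i < N) f_i)^r / r! * prod_(i < N - r) g_i. *)
Require Import Defs.
From mathcomp Require Import all_boot all_order all_algebra.
From mathcomp Require Import perm.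
Import Order.TTheory GRing.Theory Num.Theory.
Local Open Scope ring_scope.

Set Implicit Arguments.
Unset Strict Implicit.

(** * Coefficients of products of nonnegative linear polynomials *)

Lemma expr_addr_ge (R : realFieldType) (x y : R) (r : nat) : 0 <= x -> 0 <= y ->
  x ^+ r.+1 + r.+1%:R * (y * x ^+ r) <= (x + y) ^+ r.+1.
Proof.
move=> x0 y0; elim: r => [|r IHr]; first by rewrite !expr1 expr0 mul1r mulr1.
rewrite [leRHS]exprS; apply: le_trans (ler_wpM2l (addr_ge0 x0 y0) IHr).
rewrite -[r.+2%:R]natr1 [leRHS]mulrDl !mulrDr -!exprS -addrA lerD2l.
rewrite mulrDl mul1r [x * _]mulrCA [x * (y * _)]mulrCA -exprS addrA lerDl.
by rewrite !mulr_ge0 ?exprn_ge0.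
Qed.

(** Induction on [N], splitting off the last factor: the new coefficient of degree [r.+1] is [f N]
    times the old one of degree [r] plus [g N] times the old one of degree [r.+1]. Since
    [g N <= g (N - r.+1)], both bounds share the factor [P], and [expr_addr_ge], two terms of a
    binomial expansion, absorbs the remaining sum. *)
Lemma coef_prod_linear_le (R : realFieldType) (f g : nat -> R) (N r : nat) :
    (forall i, 0 <= f i) -> (forall i, 0 <= g i) ->
    {homo g : i j / (i <= j)%N >-> j <= i} ->
  (\prod_(i < N) (f i *: 'X + (g i)%:P))`_r <=
    if (r <= N)%N then
      (\sum_(i < N) f i) ^+ r / r`!%:R * \prod_(i < N - r) g i
    else 0.
Proof.
move=> f0 g0 g_dec.
have G0 M : 0 <= \prod_(i < M) g i by apply: prodr_ge0.
have S0 M : 0 <= \sum_(i < M) f i by apply: sumr_ge0.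
elim: N r => [|N IHN] r.
  rewrite big_ord0 coefC; case: r => [|r] //=.
  by rewrite expr0 big_ord0 fact0 invr1 !mulr1.
rewrite !big_ord_recr /= mulrDr coefD -scalerAr coefZ coefMX coefMC.
case: r => [|r] /=.
  rewrite mulr0 add0r expr0 fact0 invr1 !mul1r subn0 big_ord_recr /=.
  apply: ler_wpM2r => //; apply: le_trans (IHN 0%N) _.
  by rewrite subn0 expr0 fact0 divr1 mul1r.
rewrite ltnS subSS; case: leqP => [le_rN | lt_Nr]; last first.
  have := IHN r; rewrite leqNgt lt_Nr /= => A0.
  have := IHN r.+1; rewrite ltnNge (ltnW lt_Nr) /= => B0.
  by apply: le_trans (lerD (mulr_ge0_le0 (f0 N) A0) (mulr_le0_ge0 B0 (g0 N))) _; rewrite addr0.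
set S := \sum_(i < N) f i; set P := \prod_(i < N - r) g i.
have S_ge0 : 0 <= S by apply: S0.
have P_ge0 : 0 <= P by apply: G0.
have B_le : (\prod_(i < N) (f i *: 'X + (g i)%:P))`_r.+1 * g N <=
            S ^+ r.+1 / r.+1`!%:R * P.
  have [lt_rN | le_Nr] := ltnP r N.
    apply: le_trans (ler_wpM2r (g0 N) (IHN r.+1)) _.
    rewrite lt_rN /P -/S -[leLHS]mulrA ler_wpM2l ?mulr_ge0 ?invr_ge0 ?exprn_ge0 //.
    rewrite -(subnSK lt_rN) big_ord_recr /= ler_wpM2l ?G0 //.
    exact: g_dec (leq_subr _ _).
  (* Here [r = N], and degree [r.+1] exceeds that of the product, so the induction hypothesis gives
     0. *)
  apply: le_trans (ler_wpM2r (g0 N) (IHN r.+1)) _.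
  by rewrite ltnNge le_Nr /= mul0r !mulr_ge0 ?invr_ge0 ?exprn_ge0.
have A_le := ler_wpM2l (f0 N) (IHN r).
rewrite le_rN -/S -/P in A_le.
apply: le_trans (lerD A_le B_le) _.
rewrite !mulrA -mulrDl ler_wpM2r //.
have inv_ge0 : 0 <= r.+1`!%:R^-1 :> R by rewrite invr_ge0.
apply: le_trans (ler_wpM2r inv_ge0 (expr_addr_ge r S_ge0 (f0 N))).
rewrite mulrDl addrC lerD2l factS natrM -mulf_div divff ?pnatr_eq0 //.
by rewrite mul1r.
Qed.

(** * Lehmer codes of permutations *)

Lemma card_ord_lt n m : (m <= n)%N -> #|[set x : 'I_n | (x < m)%N]| = m.
Proof. by move=> le_mn; rewrite -sum1dep_card (big_ord_narrow le_mn) sum1_card card_ord. Qed.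

Section LehmerCode.

Variable n : nat.
Implicit Types (s t : 'S_n) (i x y : 'I_n).

Definition lehmer_set s i := [set x : 'I_n | (x < i)%N && (s x < s i)%N].

(** Counting the smaller earlier values, not the larger ones, makes 0 the mark of a left-to-right
    minimum. *)
Definition lehmer s i := #|lehmer_set s i|.

Lemma lehmer_le s i : (lehmer s i <= i)%N.
Proof.
apply: (@leq_trans #|[set x : 'I_n | (x < i)%N]|).
  by apply/subset_leq_card/subsetP => x; rewrite !inE => /andP[].
by rewrite card_ord_lt // ltnW.
Qed.

Lemma card_perm_below s i : #|[set x : 'I_n | (s x < s i)%N]| = s i.
Proof.
have -> : [set x | (s x < s i)%N] = s @^-1: [set y : 'I_n | (y < s i)%N].
  by apply/setP => x; rewrite !inE.
by rewrite card_preimset ?card_ord_lt // 1?ltnW //; apply: perm_inj.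
Qed.

(** By induction on [m], [s] and [t] order the positions below [m] alike: at a new position the two
    Lehmer sets are nested and equal in size, hence equal. The relative order then determines each
    value by [card_perm_below]. *)
Lemma lehmer_inj s t : lehmer s =1 lehmer t -> s = t.
Proof.
move=> eq_st.
have neq (u : 'S_n) x y : (x < y)%N -> (u x < u y)%N = ~~ (u y < u x)%N.
  move=> lt_xy; rewrite -leqNgt ltn_neqAle.
  by rewrite (inj_eq val_inj) (inj_eq perm_inj) -val_eqE neq_ltn lt_xy.
have same_order m x y : (x < m)%N -> (y < m)%N -> (s x < s y)%N = (t x < t y)%N.
  elim: m x y => // m IHm.
  (* Both sets are initial segments of the same total order on positions < m. *)
  have incl y : y = m :> nat -> ~~ (lehmer_set s y \subset lehmer_set t y) ->
      lehmer_set t y \subset lehmer_set s y.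
    move=> ym /subsetPn[a]; rewrite !inE => /andP[ay sa].
    rewrite ay -leqNgt /= => ta; apply/subsetP => b; rewrite !inE.
    move=> /andP[lt_by tb]; rewrite lt_by /=; apply: ltn_trans sa.
    by rewrite IHm -?ym // (leq_trans tb ta).
  have step x y : (x < y)%N -> y = m :> nat -> (s x < s y)%N = (t x < t y)%N.
    move=> lt_xy ym.
    have eq_set : lehmer_set s y = lehmer_set t y.
      have [sub_st | nsub_st] := boolP (lehmer_set s y \subset lehmer_set t y).
        by apply/eqP; rewrite eqEcard sub_st -[#|_|]/(lehmer t y) -eq_st /=.
      apply/esym/eqP; rewrite eqEcard incl //.
      by rewrite -[#|_|]/(lehmer s y) eq_st /=.
    by move/setP/(_ x): eq_set; rewrite !inE lt_xy.
  move=> x y; rewrite !ltnS => le_xm le_ym.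
  have [lt_xy | lt_yx | /val_inj->] := ltngtP x y; last by rewrite !ltnn.
    move: le_ym; rewrite leq_eqVlt => /predU1P[/(step _ _ lt_xy)//|lt_ym].
    exact: IHm (ltn_trans lt_xy lt_ym) lt_ym.
  rewrite -[LHS]negbK -[RHS]negbK -(neq s _ _ lt_yx) -(neq t _ _ lt_yx); congr (~~ _).
  move: le_xm; rewrite leq_eqVlt => /predU1P[/(step _ _ lt_yx)//|lt_xm].
  exact: IHm (ltn_trans lt_yx lt_xm) lt_xm.
apply/permP => i; apply/val_inj; rewrite /= -(card_perm_below s) -(card_perm_below t).
by apply: eq_card => x; rewrite !inE (same_order n).
Qed.

End LehmerCode.

(** * Optimization sets as left-to-right minima *)

Lemma vrel_lt_lt n (x y : 2.-tuple 'I_n) :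
  vrel (lt_lt n) x y =
    (tnth x ord0 < tnth y ord0)%N && (tnth x ord_max < tnth y ord_max)%N.
Proof.
apply/forallP/andP => [xy | [xy0 xy1] [[|[|//]] lt_i2]].
- by split; [have := xy ord0 | have := xy ord_max].
- by rewrite (_ : Ordinal lt_i2 = ord0) //; apply: val_inj.
- by rewrite (_ : Ordinal lt_i2 = ord_max) //; apply: val_inj.
Qed.

Lemma mem_opt_points k n (a : array k n) (j : 'I_k) (i : 'I_n) :
  (point a j i \in opt_points a j) = (lehmer (a j) i == 0%N).
Proof.
have irr : irreflexive (vrel (lt_lt n)) by move=> x; rewrite vrel_lt_lt ltnn.
have tr : transitive (vrel (lt_lt n)).
  move=> y x z; rewrite !vrel_lt_lt => /andP[xy0 xy1] /andP[yz0 yz1].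
  by rewrite (ltn_trans xy0 yz0) (ltn_trans xy1 yz1).
have := optimization_setP (lt_lt n) (points a j).
rewrite (optimization_set_strict_order _ _ irr tr) -/(opt_points a j) => /eqP ->.
rewrite inE imset_f //= cards_eq0 -[RHS]negbK; congr (~~ _).
apply/existsP/set0Pn => [[_ /andP[/imsetP[x _ ->]]] | [x]].
  by rewrite vrel_lt_lt => lt_xi; exists x; rewrite inE.
rewrite inE => lt_xi; exists (point a j x).
by rewrite imset_f //= vrel_lt_lt.
Qed.

(** * Sums over codes, one row at a time *)

Lemma sum_ffun_zeros (V : nmodType) (k n : nat) (i : 'I_n.+1) (W : nat -> V) :
  \sum_(g : {ffun 'I_k -> 'I_n.+1} | g \in ffun_on (fun x : 'I_n.+1 => (x <= i)%N))
      W #|[set j | g j == ord0]| =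
    \sum_(p < k.+1) W p *+ ('C(k, p) * i ^ (k - p)).
Proof.
(* Rows are grouped by their zero set [Z]: such a row chooses one of the [i] nonzero values at each
   of the [k - #|Z|] other coordinates. *)
pose Q (Z : {set 'I_k}) (j : 'I_k) : pred 'I_n.+1 :=
  if j \in Z then pred1 ord0 else [pred x | x \in [set x : 'I_n.+1 | (x < i.+1)%N] :\ ord0].
have fiber (Z : {set 'I_k}) (g : {ffun 'I_k -> 'I_n.+1}) :
  (g \in ffun_on (fun x : 'I_n.+1 => (x <= i)%N)) && ([set j | g j == ord0] == Z) =
    (g \in family (Q Z)).
  apply/andP/familyP => [[/ffun_onP g_le /eqP <-] j | gQ].
    rewrite /Q inE; have := g_le j; rewrite -!topredE /= => g_le_j.
    by case: ifP => // /negbT gj; rewrite !inE gj ltnS.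
  split; last first.
    apply/eqP/setP => j; rewrite inE; have := gQ j; rewrite /Q.
    by case: ifP => _; rewrite !inE // => /andP[/negPf].
  apply/ffun_onP => j; have := gQ j; rewrite /Q -topredE /=.
  case: ifP => _; first by rewrite inE => /eqP ->.
  by rewrite !inE => /andP[].
have card_fiber (Z : {set 'I_k}) : #|family (Q Z)| = (i ^ (k - #|Z|))%N.
  rewrite card_family foldrE big_map big_enum /= (bigID (mem Z)) /= big1 ?mul1n; last first.
    by move=> j Zj; rewrite /Q Zj card1.
  rewrite (eq_bigr (fun=> i : nat)).
    have -> : (k - #|Z|)%N = #|[predC Z]| by rewrite -(addKn #|Z| #|[predC Z]|) cardC card_ord.
    by rewrite -prod_nat_const; apply: eq_bigl => j; rewrite inE.
  move=> j /negPf Zj; rewrite /Q Zj.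
  have := cardsD1 ord0 [set x : 'I_n.+1 | (x < i.+1)%N].
  rewrite card_ord_lt // inE /= add1n => -[card_i].
  by rewrite [RHS]card_i; apply: eq_card => x; rewrite inE.
pose zeros (g : {ffun 'I_k -> 'I_n.+1}) := [set j | g j == ord0].
rewrite (partition_big zeros predT) //=.
(* [inord] is faithful here because [#|Z| <= k]. *)
rewrite (partition_big (fun Z : {set 'I_k} => inord #|Z| : 'I_k.+1) predT) //=.
apply: eq_bigr => p _.
have card_Z (Z : {set 'I_k}) : (inord #|Z| == p) = (#|Z| == p).
  by rewrite -val_eqE /= inordK // ltnS (leq_trans (max_card _)) ?card_ord.
rewrite (eq_bigr (fun=> W p *+ i ^ (k - p))).
  have card_p : #|[set Z : {set 'I_k} | #|Z| == p]| = 'C(k, p) by rewrite card_draws card_ord.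
  by rewrite (eq_bigl _ _ card_Z) sumr_const -mulrnA mulnC -card_p cardsE.
move=> Z; rewrite card_Z => /eqP <-; rewrite (eq_bigl _ _ (fiber Z)) -card_fiber -sumr_const.
by apply: eq_bigr => g; rewrite -fiber => /andP[_ /eqP ->].
Qed.

Section ArrayCodes.

Variables k n : nat.

Definition array_code (a : array k n.+1) : {ffun 'I_n.+1 -> {ffun 'I_k -> 'I_n.+1}} :=
  [ffun i => [ffun j => inord (lehmer (a j) i)]].

Lemma array_codeE a i j : array_code a i j = lehmer (a j) i :> nat.
Proof. by rewrite !ffunE inordK // (leq_ltn_trans (lehmer_le _ _)). Qed.

Lemma array_code_inj : injective array_code.
Proof.
move=> a b eq_ab; apply/ffunP => j; apply: lehmer_inj => i.
by rewrite -!array_codeE eq_ab.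
Qed.

Lemma array_code_hits a i : hits a i = #|[set j | array_code a i j == ord0]|.
Proof.
by apply: eq_card => j; rewrite !inE mem_opt_points -val_eqE /= array_codeE.
Qed.

Definition codes :=
  family (fun (i : 'I_n.+1) (g : {ffun 'I_k -> 'I_n.+1}) =>
    g \in ffun_on (fun x : 'I_n.+1 => (x <= i)%N)).

Lemma imset_array_code : array_code @: setT =i codes.
Proof.
have sub_codes : array_code @: setT \subset codes.
  apply/subsetP => _ /imsetP[a _ ->]; apply/familyP => i; apply/ffun_onP => j.
  by rewrite -topredE /= array_codeE lehmer_le.
apply/subset_cardP => //; rewrite card_imset ?cardsT; last exact: array_code_inj.
rewrite card_ffun card_Sn card_ord card_family foldrE big_map big_enum /=.
rewrite (eq_bigr (fun i : 'I_n.+1 => i.+1 ^ k)%N) => [|i _].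
  by rewrite fact_prod big_add1 big_mkord
    (big_morph (expn^~ k) (fun x y => expnMn x y k) (exp1n k)).
by rewrite card_ffun_on card_ord -[in RHS](card_ord_lt (ltn_ord i)) cardsE.
Qed.

(** Independence in counting form: [hits a i] depends only on row [i] of the code, and the rows vary
    freely over the box. *)
Lemma sum_array_prod (R : comNzRingType) (W : nat -> R) :
  \sum_(a : array k n.+1) \prod_(i < n.+1) W (hits a i) =
    \prod_(i < n.+1) \sum_(p < k.+1) W p *+ ('C(k, p) * i ^ (k - p)).
Proof.
under [RHS]eq_bigr do rewrite -sum_ffun_zeros.
rewrite bigA_distr_big_dep -(eq_bigl _ _ imset_array_code) big_imset /=; last first.
  by move=> a b _ _; apply: array_code_inj.
apply: eq_big => [a|a _]; first by rewrite inE.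
by apply: eq_bigr => i _; rewrite array_code_hits.
Qed.

End ArrayCodes.

(** * The generating polynomial and the sums [Fsum] *)

Lemma seqopt_num_coef k n (C : k.+1.-tuple bool) (t : nat) :
  (seqopt_num C n t%:Z)%:R =
    (\sum_(a : array k n) \prod_(i < n) 'X^(coef C (hits a i)) : {poly rat})`_t.
Proof.
rewrite coef_sum /seqopt_num -sum1dep_card natr_sum big_mkcond /=.
apply: eq_bigr => a _; rewrite prodrXr coefXn eq_sym eqz_nat.
have -> : #|selected C a| = (\sum_(i < n) coef C (hits a i))%N.
  by rewrite -sum1dep_card big_mkcond.
by case: eqP.
Qed.

Lemma coef_compl k (C : k.+1.-tuple bool) (p : 'I_k.+1) :
  coef (compl C) p = ~~ coef C p.
Proof. by rewrite /coef -tnth_nth tnth_mktuple (tnth_nth false). Qed.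

Lemma FsumSS k (C : k.+1.-tuple bool) i :
  Fsum C i.+2 = \sum_(p < k.+1) (coef C p)%:R * 'C(k, p)%:R / i.+1%:R ^+ p.
Proof. by apply: eq_bigr => p _; rewrite -[i.+2%:R]natr1 addrK div1r. Qed.

Lemma Fsum_ge0 k (C : k.+1.-tuple bool) i : 0 <= Fsum C i.+2.
Proof.
by rewrite FsumSS; apply: sumr_ge0 => p _; rewrite divr_ge0 ?mulr_ge0 ?exprn_ge0.
Qed.

Lemma Fsum_decr k (C : k.+1.-tuple bool) i j :
  (i <= j)%N -> Fsum C j.+2 <= Fsum C i.+2.
Proof.
move=> le_ij; rewrite !FsumSS; apply: ler_sum => p _.
rewrite ler_wpM2l ?mulr_ge0 // lef_pV2 ?posrE ?exprn_gt0 ?ltr0n //.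
by rewrite lerXn2r ?nnegrE ?ler_nat.
Qed.

Lemma HdotC_Fsum k (C : k.+1.-tuple bool) n :
  HdotC C n.+1 = \sum_(i < n) Fsum C i.+2.
Proof.
under [RHS]eq_bigr do rewrite FsumSS.
rewrite exchange_big; apply: eq_bigr => p _ /=.
rewrite /Hvec big_add1 big_mkord mulrC mulrA mulr_sumr.
by apply: eq_bigr => i _; rewrite div1r.
Qed.

(** Factoring out [i.+1 ^ k] leaves the weights ['C(k, p) / i.+1 ^ p]; those with c_p = 1 go to
    ['X], the others to the constant term. *)
Lemma sum_row_Fsum k (C : k.+1.-tuple bool) i :
  \sum_(p < k.+1) 'X^(coef C p) *+ ('C(k, p) * i.+1 ^ (k - p)) =
    (i.+1 ^ k)%:R *: (Fsum C i.+2 *: 'X + (Fsum (compl C) i.+2)%:P) :> {poly rat}.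
Proof.
have scale_Fsum (B : k.+1.-tuple bool) :
    (i.+1 ^ k)%:R * Fsum B i.+2 =
      \sum_(p < k.+1) (coef B p)%:R * ('C(k, p) * i.+1 ^ (k - p))%:R.
  rewrite FsumSS mulr_sumr; apply: eq_bigr => p _.
  rewrite mulrCA -mulrA natrM; do 2!congr (_ * _).
  have -> : (i.+1 ^ k = i.+1 ^ (k - p) * i.+1 ^ p)%N by rewrite -expnD subnK // -ltnS.
  by rewrite natrM [(i.+1 ^ p)%:R]natrX mulfK // expf_neq0 // pnatr_eq0.
rewrite scalerDr scalerA scale_polyC !scale_Fsum.
rewrite scaler_suml rmorph_sum -big_split; apply: eq_bigr => p _ /=.
rewrite coef_compl polyCM -mulr_natr.
case: (coef C p); rewrite ?mul1r ?mul0r ?scale0r ?addr0 ?add0r.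
  by rewrite expr1 mulr_natr scaler_nat.
by rewrite rmorph_nat.
Qed.

Theorem theorem2p3 (k n : nat) (hk : (0 < k)%N) (hn : (0 < n)%N)
    (C : k.+1.-tuple bool) (m : nat) :
  seqopt_max C n (m%:Z + (coef C k)%:Z - 1) >= (seqopt_num C n (m%:Z + (coef C k)%:Z - 1))%:R.
Proof.
rewrite seqopt_maxE; case: n hn => // n _.
set P : {poly rat} := \prod_(i < n) (Fsum C i.+2 *: 'X + (Fsum (compl C) i.+2)%:P).
have num_coef t : (seqopt_num C n.+1 t%:Z)%:R = (n`! ^ k)%:R * ('X^(coef C k) * P)`_t.
  rewrite seqopt_num_coef (sum_array_prod k n (fun p => 'X^(coef C p))) big_ord_recl.
  (* The first position is a left-to-right minimum in every column, so only [p = k] survives. *)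
  have -> : \sum_(p < k.+1) 'X^(coef C p) *+ ('C(k, p) * 0 ^ (k - p)) =
            'X^(coef C k) :> {poly rat}.
    rewrite big_ord_recr /= subnn expn0 binn mulr1n big1 ?add0r // => p _.
    by rewrite exp0n ?subn_gt0 // muln0 mulr0n.
  under eq_bigr do rewrite sum_row_Fsum.
  rewrite scaler_prod -scalerAr coefZ; congr (_ * _).
  by rewrite fact_prod big_add1 big_mkord
    (big_morph (expn^~ k) (fun x y => expnMn x y k) (exp1n k)) natr_prod.
(* For [m = 0] the count is zero: if c_k = 1, the factor ['X] kills the constant coefficient; if c_k
   = 0, the target cardinality is -1. *)
case: m => [|m] /=.
  case Ck: (coef C k); rewrite ?add0r ?subrr.
    by rewrite num_coef Ck coefXnM mulr0.
  by rewrite /seqopt_num eq_card0 // => a; rewrite inE.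
have -> : m.+1%:Z + (coef C k)%:Z - 1 = (m + coef C k)%N%:Z.
  by rewrite -addn1 !PoszD addrAC addrK.
(* The factor ['X^(coef C k)] cancels the shift by c_k, leaving the coefficient of degree [m] in
   [P]. *)
rewrite num_coef coefXnM ltnNge leq_addl addnK.
have fac_ge0 : 0 <= (n`! ^ k)%:R :> rat by [].
have := ler_wpM2l fac_ge0 (coef_prod_linear_le n m (Fsum_ge0 C)
          (Fsum_ge0 (compl C)) (Fsum_decr (compl C))).
rewrite /= ltnS HdotC_Fsum !subn1 subSS /= -/P; case: leqP => _; last by rewrite mulr0.
rewrite big_add1 /= big_mkord !mulrA [_ / _ * _ ^+ _]mulrAC.
by congr (_ <= _ * _); apply: eq_bigr => i _; rewrite addn1.
Qed.
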